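(* Let $G$ be a 2-connected bipartite graph without pairs of twins. Then $\ell_2(G)\geq |V(G)|$.
   Context: Graphs are finite and simple; a graph is 2-connected if it is connected, has at least three vertices and has no cut vertex. $d$ denotes the shortest-path distance. For distinct vertices $x,y$, $\overline{xy}^G=\{z\in V(G): d(x,y)=d(x,z)+d(z,y)\ \text{or}\ d(x,y)=|d(x,z)-d(z,y)|\}$. $\ell_2(G)$ is the number of distinct sets $\overline{xy}^G$ over all pairs $x,y$ with $d(x,y)=2$. A pair of twins is a pair $(v,v')$ of distinct vertices with $d(v,v')\neq 1$ and $d(v,u)=d(v',u)$ for every vertex $u\notin\{v,v'\}$. *)

(* Defs.v *)
(* MathComp.  A finite simple graph is a symmetric irreflexive [e : rel T] on a
   finite type [T] of vertices. *)
From mathcomp Require Import all_boot ssrint.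

Set Implicit Arguments.
Unset Strict Implicit.
Unset Printing Implicit Defensive.

Section Graphs.

Variables (T : finType) (e : rel T).

Definition walk_of_length (x y : T) (n : nat) : bool :=
  [exists p : n.-tuple T, path e x p && (last x p == y)].

(* The least length of a walk from [x] to [y]; a shortest walk has fewer than
   [#|T|] edges.  The value is [#|T|] when [x] and [y] are not connected. *)
Definition dist (x y : T) : nat :=
  find (walk_of_length x y) (iota 0 #|T|).

Definition connected_graph : Prop := forall x y : T, connect e x y.

Definition del_vertex (v : T) : rel T :=
  [rel x y | [&& e x y, x != v & y != v]].

(* [v] separates two other vertices of one connected component. *)
Definition cut_vertex (v : T) : Prop :=
  exists x y : T,
    [/\ x != v, y != v, connect e x y & ~~ connect (del_vertex v) x y].

Definition two_connected : Prop :=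
  [/\ connected_graph, 3 <= #|T| & forall v : T, ~ cut_vertex v].

Definition bipartite : Prop :=
  exists A : {set T}, forall x y : T, e x y -> (x \in A) != (y \in A).

Definition twins (v v' : T) : Prop :=
  [/\ v != v', dist v v' != 1 &
      forall u : T, u != v -> u != v' -> dist v u = dist v' u].

Definition line (x y : T) : {set T} :=
  [set z | (dist x y == dist x z + dist z y)
           || (dist x y == `|dist x z - dist z y|%N)].

Definition ell2 : nat :=
  #|[set line x y | x in T, y in T & dist x y == 2]|.

End Graphs.

(* Main.v *)
(* Call two vertices at distance 2 a pair, and join the two vertices of each
   pair: this gives a connected graph on each colour class.
   If two different pairs generate the same line, they can be written x y and
   u v with x, y, u, v in this order on a shortest path; then all the
   neighbours of x are neighbours of y, for otherwise x would be a cut vertex.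
   As there are no twins, some o outside the line splits the neighbourhood of x,
   and x, o, y are pairwise at distance 2; this lets one choose a single
   generating pair for each line without losing connectivity.  The chosen pairs
   then form a spanning subgraph with two components, and it remains connected
   on each colour class after the deletion of two suitable pairs.  Hence the
   number of lines is at least (|V| - 2) + 2. *)
Require Import Defs.
From mathcomp Require Import all_boot ssrint zify.

Set Implicit Arguments.
Unset Strict Implicit.
Unset Printing Implicit Defensive.

(** * Closed sets and edge counts of connected graphs *)

Lemma connect_closed (T : finType) (r : rel T) (P : pred T) x y :
  connect r x y -> P x -> (forall a b, r a b -> P a -> P b) -> P y.
Proof.
move=> /connectP[p + ->] + rP; elim: p x => //= z p IH x /andP[rxz rp] Px.
exact: IH rp (rP _ _ rxz Px).
Qed.

(** A tree is grown implicitly: take a largest [K] inside [D] that contains [x] and has at least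
    [#|K| - 1] pairs inside it. A pair leaving [K] would bring in one vertex and at least one new
    pair, so [K] is closed under adjacency and equals [D]. *)
Lemma connected_card (T : finType) (P : {set T * T}) (D : {set T}) :
  (forall p, p \in P -> (p.1 \in D) = (p.2 \in D)) ->
  {in D &, forall x y,
    connect [rel a b | ((a, b) \in P) || ((b, a) \in P)] x y} ->
  #|D| <= #|[set p in P | p.1 \in D]|.+1.
Proof.
move=> closedD connD; have [->|[x xD]] := set_0Vmem D; first by rewrite cards0.
pose inner (K : {set T}) := [set p in P | (p.1 \in K) && (p.2 \in K)].
pose Q (K : {set T}) := [&& x \in K, K \subset D & #|K| <= #|inner K|.+1].
have Qx : Q [set x] by rewrite /Q set11 sub1set xD cards1.
case: (arg_maxnP (fun K : {set T} => #|K|) Qx) => K /and3P[xK KD cK] maxK.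
suff DK : D \subset K.
  have -> : D = K by apply/eqP; rewrite eqEsubset DK.
  apply: leq_trans cK _; rewrite ltnS; apply/subset_leq_card/subsetP => p.
  by rewrite !inE => /and3P[-> ->].
suff step a b : ((a, b) \in P) || ((b, a) \in P) -> a \in K -> b \in K.
  by apply/subsetP => y yD; apply: connect_closed (connD x y xD yD) xK step.
move=> rab aK; apply/negPn/negP => bK.
have aD := subsetP KD a aK.
have bD : b \in D by case/orP: rab => /closedD /=; rewrite aD.
suff /maxK : Q (b |: K) by rewrite /= cardsU1 bK add1n ltnn.
rewrite /Q !inE xK orbT subUset sub1set bD KD cardsU1 bK /= add1n ltnS.
apply: leq_trans cK _; apply: proper_card.
apply/properP; split.
  by apply/subsetP => p; rewrite !inE => /and3P[-> -> ->]; rewrite !orbT.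
case/orP: rab => abP; [exists (a, b)|exists (b, a)];
  by rewrite !inE /= ?abP ?eqxx ?aK ?(negPf bK) ?orbT ?andbF.
Qed.

(** * Distances and lines in a connected bipartite graph *)

Section TwoConnectedBipartite.

Variables (T : finType) (e : rel T).
Hypothesis e_sym : symmetric e.
Hypothesis e_irr : irreflexive e.
Hypothesis e_conn : connected_graph e.
Variable f : T -> bool.
Hypothesis f_col : forall x y, e x y -> f x != f y.

Notation d := (dist e).

Lemma walkP x y n :
  reflect (exists2 p, path e x p & size p = n /\ last x p = y)
          (walk_of_length e x y n).
Proof.
apply: (iffP existsP) => [[p /andP[ep /eqP lp]]|[p ep [sp lp]]].
  by exists p => //; rewrite size_tuple.
by exists (tcast sp (in_tuple p)); rewrite val_tcast ep lp eqxx.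
Qed.

Lemma dist_walk x y : walk_of_length e x y (d x y).
Proof.
have [p ep lp] := connectP (e_conn x y).
case/shortenP: ep lp => q eq uq _ lq.
(* [dist] searches only lengths below [#|T|], which a duplicate-free walk respects. *)
have sq : size q < #|T|.
  by rewrite -[(size q).+1]/(size (x :: q)) -(card_uniqP uq) max_card.
have h : has (walk_of_length e x y) (iota 0 #|T|).
  by apply/hasP; exists (size q); [rewrite mem_iota|apply/walkP; exists q].
have := nth_find 0 h; rewrite nth_iota //.
by rewrite -[X in _ < X](size_iota 0) -has_find.
Qed.

Lemma dist_le x y n : walk_of_length e x y n -> d x y <= n.
Proof.
move=> w; case: (ltnP n #|T|) => [nT|]; last first.
  by apply: leq_trans; rewrite -[X in _ <= X](size_iota 0) find_size.
by rewrite leqNgt; apply/negP => /(before_find 0); rewrite nth_iota // w.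
Qed.

Lemma dist_eq0 x y : (d x y == 0) = (x == y).
Proof.
apply/eqP/eqP => [d0|->].
  by have := dist_walk x y; rewrite d0 => /walkP[[|z p] _ []].
by apply/eqP; rewrite -leqn0; apply: dist_le; apply/walkP; exists [::].
Qed.

Lemma distxx x : d x x = 0. Proof. by apply/eqP; rewrite dist_eq0. Qed.

Lemma distC x y : d x y = d y x.
Proof.
suff le a b : d a b <= d b a by apply/eqP; rewrite eqn_leq !le.
apply: dist_le; have /walkP[p ep [sp lp]] := dist_walk b a; apply/walkP.
exists (rev (belast b p)); last first.
  rewrite size_rev size_belast sp; split => //.
  by case: p {ep sp} lp => [|c p] //= _; rewrite rev_cons last_rcons.
by rewrite -lp rev_path; apply: sub_path ep => ? ?; rewrite e_sym.
Qed.

Lemma dist_triangle y x z : d x z <= d x y + d y z.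
Proof.
have /walkP[p ep [sp lp]] := dist_walk x y.
have /walkP[q eq [sq lq]] := dist_walk y z.
apply: dist_le; apply/walkP; exists (p ++ q); first by rewrite cat_path ep lp.
by rewrite size_cat sp sq last_cat lp.
Qed.

Lemma dist_eq1 x y : (d x y == 1) = e x y.
Proof.
apply/eqP/idP => [d1|exy].
  have := dist_walk x y; rewrite d1 => /walkP[[|c [|z p]]] /=; try by move=> _ [].
  by rewrite andbT => exc [_ <-].
apply/eqP; rewrite eqn_leq lt0n dist_eq0 dist_le /=; last first.
  by apply/walkP; exists [:: y] => //=; rewrite exy.
by apply: contraTneq exy => ->; rewrite e_irr.
Qed.

Lemma dist_step x y : x != y -> exists2 z, e x z & d x y = (d z y).+1.
Proof.
rewrite -dist_eq0 => nxy; have /walkP[[|z p] /=] := dist_walk x y.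
  by move=> _ [h]; rewrite -h in nxy.
case/andP=> exz ep [sp lp]; exists z => //.
have le1 : d z y <= size p by apply: dist_le; apply/walkP; exists p.
have := dist_triangle z x y; have/eqP-> : d x z == 1 by rewrite dist_eq1.
lia.
Qed.

Lemma odd_dist x y : odd (d x y) = (f x != f y).
Proof.
have /walkP[p ep [<- <-]] := dist_walk x y; move: ep.
elim: p x => [|z p IH] x /=; first by rewrite eqxx.
by case/andP=> /f_col + /IH ->; move: (f x) (f z) (f (last z p)) => [] [] [].
Qed.

(** The distances differ by at most one, and parity excludes equality. *)
Lemma edge_dist x y z : e x y ->
  (d x z = (d y z).+1) \/ (d y z = (d x z).+1).
Proof.
move=> exy; have /eqP d1 : d x y == 1 by rewrite dist_eq1.
have := dist_triangle y x z; have := dist_triangle x y z.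
have := odd_dist x z; have := odd_dist y z; rewrite (distC y x) d1.
by have := f_col exy; move: (f x) (f y) (f z) => [] [] [] //=; lia.
Qed.

(** A vertex between [x] and [y] other than these two is a common neighbour; the ends themselves
    fall under the first two cases. *)
Lemma line_cases x y z : d x y = 2 ->
  (z \in line e x y) =
  [|| d x z == d y z + 2, d y z == d x z + 2 | e x z && e y z].
Proof.
move=> dxy; rewrite inE dxy -!dist_eq1 (distC z y).
have := dist_triangle x y z; have := dist_triangle y x z.
rewrite (distC y x) dxy; have := odd_dist x z; have := odd_dist y z.
have : f x = f y.
  by have := odd_dist x y; rewrite dxy /=; move: (f x) (f y) => [] [].
move=> ->; set a := d x z; set b := d y z => h1; rewrite -h1 => h2 h3 h4.
have [le|le] := leqP a b; first by rewrite distnC distnEl //; lia.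
by rewrite distnEl ?(ltnW le) //; lia.
Qed.

(** By parity the two distances differ by 0 or 2, and a difference of 2 puts [z] on the line. *)
Lemma notin_line x y z : d x y = 2 -> z \notin line e x y -> d x z = d y z.
Proof.
move=> dxy; rewrite line_cases //.
have := dist_triangle x y z; have := dist_triangle y x z.
rewrite (distC y x) dxy; have := odd_dist x z; have := odd_dist y z.
have : f x = f y.
  by have := odd_dist x y; rewrite dxy /=; move: (f x) (f y) => [] [].
by move=> ->; lia.
Qed.

Lemma lineC x y : line e x y = line e y x.
Proof.
apply/setP => z; rewrite !inE (distC x y) !(distC _ z) addnC.
by rewrite distnC.
Qed.

(** * Consequences of 2-connectivity and of the absence of twins *)

Hypothesis e_card : 3 <= #|T|.
Hypothesis e_nocut : forall v, ~ cut_vertex e v.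
Hypothesis e_notwins : forall v v', ~ twins e v v'.

Lemma connect_del v x y : x != v -> y != v -> connect (del_vertex e v) x y.
Proof.
move=> xv yv; apply/negPn/negP => nc; apply: (@e_nocut v).
by exists x, y; split.
Qed.

(** A geodesic from [x] to a third vertex starts with a neighbour shared with [y], so equal
    neighbourhoods give equal distances. *)
Lemma same_nbrs x y : e x =1 e y -> x = y.
Proof.
move=> N; apply/eqP/negPn/negP => xy; apply: (@e_notwins x y); split=> //.
  by rewrite dist_eq1 N e_irr.
have le a b u : e a =1 e b -> u != a -> d b u <= d a u.
  move=> Nab; rewrite eq_sym => /dist_step[w]; rewrite Nab => ebw ->.
  by case: (edge_dist u ebw) => ->; lia.
move=> u ux uy; apply/eqP; rewrite eqn_leq !le //.
Qed.

(** Some third vertex is reached from [x] by a walk avoiding [c], and the first step of that walk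
    gives [c']. *)
Lemma other_nbr x c : e x c -> exists2 c', e x c' & c' != c.
Proof.
move=> exc; have xc : x != c by apply: contraTneq exc => ->; rewrite e_irr.
have [z] : exists z, z \notin [:: x; c].
  apply/existsP; apply: contraTT e_card => /existsPn all_in.
  rewrite -ltnNge ltnS; apply: leq_trans (card_size [:: x; c]).
  by apply/subset_leq_card/subsetP => z _; apply/negPn/all_in.
rewrite !inE negb_or => /andP[zx zc].
have [[|w p] /= ep lp] := connectP (connect_del xc zc).
  by rewrite lp eqxx in zx.
by case/andP: ep => /and3P[exw _ wc] _; exists w.
Qed.

Lemma has_nbr x : exists c, e x c.
Proof.
have [y xy] : exists y, x != y.
  apply/existsP; apply: contraTT e_card => /existsPn all_eq.
  rewrite -ltnNge ltnS; apply: leq_trans (_ : #|[:: x]| <= 2).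
    by apply/subset_leq_card/subsetP => z _; rewrite inE eq_sym; apply/negPn.
  exact: leq_trans (card_size _) _.
by have [z exz _] := dist_step xy; exists z.
Qed.

Lemma dist2_common x y : d x y = 2 -> exists2 c, e x c & e y c.
Proof.
move=> dxy; have xy : x != y by rewrite -dist_eq0 dxy.
have [c exc] := dist_step xy; rewrite dxy => -[/esym/eqP].
by rewrite dist_eq1 e_sym => eyc; exists c.
Qed.

Lemma common_dist2 x y c : e x c -> e y c -> x != y -> d x y = 2.
Proof.
move=> exc eyc; rewrite -dist_eq0.
have := edge_dist y exc; have /eqP-> : d c y == 1 by rewrite dist_eq1 e_sym.
by lia.
Qed.

Lemma edge_colC x y : e x y -> f y = ~~ f x.
Proof. by move/f_col; move: (f x) (f y) => [] []. Qed.

Lemma dist2_col x y : d x y = 2 -> f x = f y.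
Proof.
by move=> dxy; have := odd_dist x y; rewrite dxy; move: (f x) (f y) => [] [].
Qed.

Lemma mem_line x y : x \in line e x y.
Proof. by rewrite inE distxx add0n eqxx. Qed.

Lemma nbr_line x y z : d x y = 2 -> e x z -> z \in line e x y.
Proof.
move=> dxy exz; rewrite line_cases // exz -(dist_eq1 y z).
have/eqP-> : d x z == 1 by rewrite dist_eq1.
by have := edge_dist y exz; rewrite (distC z) dxy; lia.
Qed.

(** Here [z] is within distance 2 of both ends, so lying beyond one of them means being that end;
    the colours forbid a common neighbour. *)
Lemma common_line x y c z : d x y = 2 -> e x c -> e y c -> e c z ->
  z \in line e x y -> z = x \/ z = y.
Proof.
move=> dxy exc eyc ecz; rewrite line_cases //.
have /eqP d1 : d x c == 1 by rewrite dist_eq1.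
have /eqP d2 : d y c == 1 by rewrite dist_eq1.
have /eqP d3 : d c z == 1 by rewrite dist_eq1.
have := dist_triangle c x z; have := dist_triangle c y z; rewrite d1 d2 d3.
move=> t1 t2 /or3P[/eqP|/eqP|/andP[exz _]].
- by move=> *; right; apply/esym/eqP; rewrite -dist_eq0; lia.
- by move=> *; left; apply/esym/eqP; rewrite -dist_eq0; lia.
move: (f_col exc) (f_col ecz) (f_col exz).
by move: (f x) (f c) (f z) => [] [] [].
Qed.

(** On a line containing all vertices, every common neighbour of [x] and [y] has only these two
    neighbours, so without twins there is just one, [c]. The side of [x] could then be left only
    through [c], which would be a cut vertex. *)
Lemma line_proper x y : d x y = 2 -> exists o, o \notin line e x y.
Proof.
move=> dxy; case: (boolP [exists o, o \notin line e x y]) => [/existsP//|].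
move=> /existsPn all_in; exfalso.
have [c exc eyc] := dist2_common dxy.
have nbrs c' : e x c' -> e y c' -> e c' =1 pred2 x y.
  move=> exc' eyc' z /=; apply/idP/orP.
    move=> ec'z; case: (common_line dxy exc' eyc' ec'z) => [|->|->].
    - exact/negPn/all_in.
    - by left.
    - by right.
  by case=> /eqP->; rewrite e_sym.
have xc : x != c by apply: contraTneq exc => ->; rewrite e_irr.
have yc : y != c by apply: contraTneq eyc => ->; rewrite e_irr.
have := connect_closed (P := fun z => d y z == d x z + 2) (connect_del xc yc).
rewrite !distxx (distC y x) dxy /=.
suff step a b : del_vertex e c a b -> d y a == d x a + 2 -> d y b == d x b + 2.
  by move/(_ isT step).
case/and3P=> eab _ bc /eqP da.
have := negPn (all_in b); rewrite line_cases //.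
have := edge_dist x eab; have := edge_dist y eab; rewrite !(distC a) !(distC b).
move=> h1 h2 /or3P[/eqP|//|/andP[exb eyb]]; first by lia.
case/eqP: bc; apply: same_nbrs => z.
by rewrite (nbrs b) ?(nbrs c).
Qed.

(** * Pairs at distance 2 generating the same line *)

(** By [common_line], [u] may be taken as a common neighbour of [x] and [y]. Then [x] has no
    neighbours but [u], [v], and [u] none but [x], [y]. A vertex [o] off the line is equidistant
    from the ends of each pair, so each of [x] and [u] would be one step farther from [o] than the
    other. *)
Lemma end_not_middle x y u v : d x y = 2 -> d u v = 2 ->
  line e x y = line e u v -> e x u -> e x v -> False.
Proof.
move=> dxy; have [c exc eyc] := dist2_common dxy.
wlog cu : u v / c = u => [IH|] duv L exu exv.
  have : c \in line e u v by rewrite -L nbr_line.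
  case/(common_line duv (_ : e u x) (_ : e v x) exc); rewrite 1?e_sym // => E.
    exact: IH E duv L exu exv.
  by apply: IH E _ _ exv exu; rewrite 1?distC // L lineC.
move: exc eyc; rewrite {c}cu => _ eyu.
have [o oL] := line_proper dxy.
have oL' : o \notin line e u v by rewrite -L.
have xo : x != o by apply: contraNneq oL => <-; rewrite mem_line.
have uo : u != o by apply: contraNneq oL' => <-; rewrite mem_line.
have [w exw dxo] := dist_step xo; have [w' euw' duo] := dist_step uo.
have wo : d w o = d u o.
  have : w \in line e u v by rewrite -L nbr_line.
  case/(common_line duv (_ : e u x) (_ : e v x) exw); rewrite 1?e_sym // => -> //.
  by rewrite (notin_line duv oL').
have w'o : d w' o = d x o.
  have : w' \in line e x y by rewrite L nbr_line.
  by case/(common_line dxy exu eyu euw') => -> //; rewrite (notin_line dxy oL).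
by move: dxo duo; rewrite wo w'o; clear; lia.
Qed.

Definition same_pair (x y u v : T) : bool :=
  ((u, v) == (x, y)) || ((u, v) == (y, x)).

Lemma same_pairC x y u v : same_pair x y v u = same_pair x y u v.
Proof. by rewrite /same_pair !xpair_eqE orbC ![(v == _) && _]andbC. Qed.

Lemma same_pair_sym x y u v : same_pair u v x y = same_pair x y u v.
Proof.
rewrite /same_pair !xpair_eqE !(eq_sym u) !(eq_sym v).
by congr orb; rewrite andbC.
Qed.

Lemma middle_disjoint x y u v c : d x y = 2 -> d u v = 2 ->
  line e x y = line e u v -> e x c -> e y c -> e u c -> e v c ->
  same_pair x y u v.
Proof.
move=> dxy duv L exc eyc euc evc.
have uL : u \in line e x y by rewrite L mem_line.
have vL : v \in line e x y by rewrite L lineC mem_line.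
have ecu : e c u by rewrite e_sym.
have ecv : e c v by rewrite e_sym.
have := common_line dxy exc eyc ecu uL; have := common_line dxy exc eyc ecv vL.
by move=> [E1|E1] [E2|E2]; move: duv;
  rewrite /same_pair E1 E2 ?distxx ?eqxx ?orbT.
Qed.

(** Along an edge the difference of the distances to [x] and [y] changes by at most 2, so it cannot
    pass from 2 to -2. *)
Lemma side_edge x y a b : d x y = 2 -> e a b -> b \in line e x y ->
  ~~ (e x b && e y b) -> d y a = d x a + 2 -> d y b = d x b + 2.
Proof.
move=> dxy eab bL nb da; move: bL; rewrite line_cases // (negPf nb) orbF.
have := edge_dist x eab; have := edge_dist y eab.
rewrite !(distC a) !(distC b) => h1 h2 /orP[/eqP|/eqP//]; lia.
Qed.

(** The walk [x], [c], [y] stays on the line, and neither [c] nor [y] is a common neighbour of [u]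
    and [v], by [middle_disjoint] and [end_not_middle]. *)
Lemma same_side x y u v : d x y = 2 -> d u v = 2 ->
  line e x y = line e u v -> ~~ same_pair x y u v ->
  d v x = d u x + 2 -> d v y = d u y + 2.
Proof.
move=> dxy duv L nsame; have [c exc eyc] := dist2_common dxy.
have cL : c \in line e u v by rewrite -L nbr_line.
have yL : y \in line e u v by rewrite -L lineC mem_line.
have dyx : d y x = 2 by rewrite distC.
have nc : ~~ (e u c && e v c).
  apply: contra nsame => /andP[euc evc].
  exact: middle_disjoint duv L exc eyc euc evc.
have ny : ~~ (e u y && e v y).
  apply/andP; rewrite ![e _ y]e_sym => -[]; apply: end_not_middle dyx duv _.
  by rewrite lineC.
move/(side_edge duv exc cL nc); apply: side_edge => //.
by rewrite e_sym.
Qed.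

(* The last condition says that some shortest path meets [x], [y], [u], [v] in
   this order. *)
Definition chained (x y u v : T) : Prop :=
  [/\ d x y = 2, d u v = 2, line e x y = line e u v & d x v = d y u + 4].

Lemma chainedC x y u v : chained x y u v -> chained v u y x.
Proof.
case=> dxy duv L dxv; split; rewrite 1?distC //; first by rewrite lineC -L lineC.
by rewrite dxv (distC y).
Qed.

(** By [same_side] each pair lies on one side of the other. Naming the near ends [y] and [u], the
    two gaps of 2 add up. *)
Lemma chained_exists x y u v : d x y = 2 -> d u v = 2 ->
  line e x y = line e u v -> ~~ same_pair x y u v ->
  exists a b c g, [/\ (a, b) = (x, y) \/ (a, b) = (y, x),
    (c, g) = (u, v) \/ (c, g) = (v, u) & chained a b c g].
Proof.
move=> dxy.
wlog dvx : u v / d v x = d u x + 2 => [IH|] duv L nsame.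
  have : x \in line e u v by rewrite -L mem_line.
  rewrite line_cases // => /or3P[/eqP|/eqP|/andP[]].
  - rewrite distC in duv; rewrite (lineC u) in L; rewrite -same_pairC in nsame => h.
    have [a [b [c [g [h1 h2 h3]]]]] := IH _ _ h duv L nsame.
    by exists a, b, c, g; split=> //; case: h2; [right|left].
  - by move/IH; apply.
  - rewrite ![e _ x]e_sym => exu exv.
    by case: (end_not_middle dxy duv L exu exv).
have dvy := same_side dxy duv L nsame dvx.
have L' : line e u v = line e x y by [].
have ns' : ~~ same_pair u v x y by rewrite same_pair_sym.
have : u \in line e x y by rewrite L mem_line.
rewrite line_cases // => /or3P[/eqP h|/eqP h|/andP[]].
- have dyx : d y x = 2 by rewrite distC.
  have h1 : d x v = d y v + 2.
    apply: (same_side duv dyx _ _ h); last by rewrite same_pairC.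
    by rewrite -L (lineC x).
  exists x, y, u, v; split; [by left|by left|split=> //].
  by rewrite h1 (distC y v) dvy (distC u y); lia.
- have h1 := same_side duv dxy L' ns' h.
  exists y, x, u, v; split; [by right|by left|split=> //].
  + by rewrite distC.
  + by rewrite lineC.
  by rewrite h1 (distC x v) dvx (distC u x); lia.
rewrite ![e _ u]e_sym => eux euy.
by case: (end_not_middle duv dxy L' eux euy).
Qed.

Lemma chained_dist x y u v : chained x y u v ->
  d x u = d y u + 2 /\ d y v = d y u + 2.
Proof.
case=> dxy duv _ dxv.
have := dist_triangle u x v; have := dist_triangle y x v.
by have := dist_triangle u y v; have := dist_triangle y x u; lia.
Qed.

(* Let [X] be the side of [x] in the line: the vertices [z] reaching [y] through
   [x].  Geodesics from [X] to [u] and [v] run through [x] and [y] inside the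
   line, so a vertex outside the line that is adjacent to [X] would be closer to
   [u] than to [v].  Hence [X] can only be left through [x], and [X] is reduced
   to [x] because [x] is not a cut vertex. *)
Lemma chained_sub x y u v : chained x y u v -> {subset e x <= e y}.
Proof.
move=> ch; have [dxu dyv] := chained_dist ch; have [dxy duv L dxv] := ch.
have Xline z : d y z = d x z + 2 -> z \in line e x y.
  by rewrite line_cases // => ->; rewrite eqxx orbT.
have X_near_u z : d y z = d x z + 2 -> d v z = d u z + 2.
  elim: {z}(d x z) {-2}z (erefl (d x z)) => [|n IH] z dxz Xz.
    move/eqP: dxz; rewrite dist_eq0 => /eqP <-.
    by rewrite (distC v) (distC u) dxv dxu; lia.
  have zx : z != x by rewrite -dist_eq0 distC dxz.
  have [z' ezz' ] := dist_step zx; rewrite distC dxz => -[dz'x].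
  have Xz' : d y z' = d x z' + 2.
    have := edge_dist y ezz'; have := dist_triangle x y z'.
    have := (distC y x, distC y z, distC y z', distC x z').
    by move=> [[[+ +] +] +]; lia.
  apply: (side_edge duv _ _ _ (IH z' _ Xz')).
  - by rewrite e_sym.
  - by rewrite -L Xline.
  - apply/andP => -[euz evz].
    have := edge_dist x evz; have := edge_dist y euz.
    by have := (distC x v, distC y u, distC z x, distC z y);
      move=> [[[+ +] +] +]; lia.
  - by rewrite distC.
have X_far_u z : d y z = d x z + 2 -> d y z + d y u <= d u z.
  elim: {z}(d u z) {-2}z (erefl (d u z)) => [|n IH] z duz Xz.
    move/eqP: duz; rewrite dist_eq0 => /eqP uz.
    by move: Xz; rewrite -uz; lia.
  have zu : z != u by rewrite -dist_eq0 distC duz.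
  have [w ezw] := dist_step zu; rewrite distC duz => -[dwu].
  have wL : w \in line e x y.
    rewrite L line_cases //.
    have := edge_dist v ezw; have := dist_triangle u v w.
    rewrite (distC v u) duv !(distC _ v) (X_near_u _ Xz) duz (distC u w) -dwu.
    by lia.
  have ewz : e w z by rewrite e_sym.
  move: (wL); rewrite line_cases // => /or3P[/eqP|/eqP Xw|/andP[exw eyw]].
  - by have := edge_dist x ezw; have := edge_dist y ezw;
      rewrite !(distC _ x) !(distC _ y); lia.
  - have := IH w; rewrite distC => /(_ (esym dwu) Xw).
    by have := edge_dist y ezw; rewrite !(distC _ y); lia.
  case: (common_line dxy exw eyw ewz (Xline _ Xz)) => E.
    by move: duz; rewrite E (distC y x) dxy (distC u x); lia.
  by move: Xz; rewrite E distxx; lia.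
(* Equidistance from the ends of both pairs gives [d u o = d u z + 1] and [d y o = d y z - 1],
   against [X_far_u]. *)
have X_closed z o : d y z = d x z + 2 -> e z o -> o \in line e x y.
  move=> Xz ezo; apply/negPn/negP => oL.
  have oL' : o \notin line e u v by rewrite -L.
  have := notin_line dxy oL; have := notin_line duv oL'.
  have := edge_dist x ezo; have := edge_dist y ezo; have := edge_dist v ezo.
  have := X_near_u _ Xz; have := X_far_u _ Xz; have := dist_triangle y u o.
  by rewrite !(distC _ x) !(distC _ y) !(distC _ v); lia.
have X_step a b : a != x -> d y a = d x a + 2 -> e a b -> d y b = d x b + 2.
  move=> ax Xa eab; apply: (side_edge dxy eab (X_closed _ _ Xa eab) _ Xa).
  apply/andP => -[exb eyb]; have eba : e b a by rewrite e_sym.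
  case: (common_line dxy exb eyb eba (Xline _ Xa)) => E.
    by rewrite E eqxx in ax.
  by move: Xa; rewrite E distxx; lia.
move=> c; rewrite !unfold_in => exc.
have := nbr_line dxy exc; rewrite line_cases // => /or3P[/eqP|/eqP Xc|/andP[]//].
  by move: exc; rewrite -dist_eq1 => /eqP->; lia.
have cx : c != x by apply: contraTneq exc => ->; rewrite e_irr.
have yx : y != x by rewrite -dist_eq0 distC dxy.
have := connect_closed (P := fun z => d y z == d x z + 2) (connect_del cx yx).
rewrite distxx dxy Xc eqxx => /(_ isT) conn_y; exfalso.
suff /conn_y : forall a b, del_vertex e x a b ->
  d y a == d x a + 2 -> d y b == d x b + 2 by [].
by move=> a b /and3P[eab ax _] /eqP Xa; apply/eqP; exact: X_step ax Xa eab.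
Qed.

Lemma distinct_nbr_splits c c' : c != c' -> exists o, e o c != e o c'.
Proof.
move=> cc'; apply/existsP; apply: contraNT cc' => /existsPn N.
apply/eqP/same_nbrs => z; rewrite !(e_sym _ z).
by apply/eqP; have := N z; rewrite negbK.
Qed.

(** Two neighbours of [x] are not twins. As they are also neighbours of [y], the vertex [o]
    separating them is neither [x] nor [y]. *)
Lemma chained_split x y u v : chained x y u v ->
  exists o c c', [/\ e x c, e x c', e o c & ~~ e o c'].
Proof.
move=> ch; have [c exc] := has_nbr x; have [c' exc' cc'] := other_nbr exc.
have [o] := distinct_nbr_splits cc'.
case oc: (e o c); case oc': (e o c') => // _.
  by exists o, c, c'; rewrite oc oc'.
by exists o, c', c; rewrite oc oc'.
Qed.

(** As [c] is adjacent to both [x] and [y], [common_line] keeps [o] off the line, hence equidistant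
    from [u] and [v]; going through [c] gives [d u o <= d y u + 2 <= d v o]. *)
Lemma chained_out x y u v o c : chained x y u v -> e x c -> e o c ->
  o != x -> o != y ->
  [/\ o \notin line e x y, d x o = 2, d o y = 2, d u o = d y u + 2
    & d v o = d y u + 2].
Proof.
move=> ch exc eoc ox oy; have [dxu dyv] := chained_dist ch.
have [dxy duv L dxv] := ch; have eyc : e y c := chained_sub ch exc.
have eco : e c o by rewrite e_sym.
have oL : o \notin line e x y.
  apply: contra_notN (_ : ~ (o = x \/ o = y)); last first.
    by case=> E; rewrite E eqxx in ox oy.
  exact: common_line eyc eco.
have oL' : o \notin line e u v by rewrite -L.
have dxo : d x o = 2 by rewrite (common_dist2 exc eoc) 1?eq_sym.
have doy : d o y = 2 by rewrite (common_dist2 eoc eyc).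
have := notin_line duv oL'; have := dist_triangle y u o.
have := dist_triangle c u o; have := edge_dist u exc; have := edge_dist v exc.
have := edge_dist u eyc; have := edge_dist v eyc.
have := edge_dist u eoc; have := edge_dist v eoc.
rewrite !(distC _ u) !(distC _ v) (distC u x) (distC v x) (distC y o) (distC v y).
by rewrite (distC u y); move: dxu dyv dxv; clear -oL dxo doy; split=> //; lia.
Qed.

(** * Pairs that are the only generators of their line *)

Definition lone (x y : T) : bool :=
  [forall u, forall v, (d u v == 2) && (line e u v == line e x y) ==>
    same_pair x y u v].

Lemma loneP x y u v : lone x y -> d u v = 2 -> line e u v = line e x y ->
  same_pair x y u v.
Proof.
move=> /forallP/(_ u)/forallP/(_ v)/implyP lxy duv L.
by apply: lxy; rewrite duv L !eqxx.
Qed.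

Lemma not_lone_chained x y : d x y = 2 -> ~~ lone x y ->
  exists a b u v, ((a, b) = (x, y) \/ (a, b) = (y, x)) /\ chained a b u v.
Proof.
move=> dxy /forallPn[u /forallPn[v]]; rewrite negb_imply.
case/andP=> /andP[/eqP duv /eqP L] ns.
have [a [b [c [g [ab _ ch]]]]] := chained_exists dxy duv (esym L) ns.
by exists a, b, c, g.
Qed.

Lemma chained_not_lone x y u v : chained x y u v -> ~~ lone x y.
Proof.
move=> ch; have [dxy duv L dxv] := ch; apply/negP => /loneP/(_ duv (esym L)).
by case/orP=> /eqP[E1 E2]; move: dxv; rewrite E1 E2 ?distxx ?dxy ?(distC y x); lia.
Qed.

(** A pair sharing its line is chained up to order, and [chained_sub] then nests one neighbourhood
    in the other. *)
Lemma lone_unnested x y c c' : d x y = 2 -> e x c -> ~~ e y c ->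
  e y c' -> ~~ e x c' -> lone x y.
Proof.
move=> dxy exc eyc eyc' exc'; apply/negPn/negP => /(not_lone_chained dxy).
case=> a [b [u [v [ab /chained_sub sub]]]].
by case: ab sub => -[-> ->] sub; [case/negP: eyc|case/negP: exc']; apply: sub.
Qed.

(** * The graph formed by one generating pair for each line *)

Definition generator (l : {set T}) : option (T * T) :=
  [pick p : T * T | (d p.1 p.2 == 2) && (line e p.1 p.2 == l)].

(** A pair and its reversal have the same line, so at most one of them is present; [adj] restores
    the symmetry. *)
Definition generators (E : {set {set T}}) : {set T * T} :=
  [set p | [&& d p.1 p.2 == 2, line e p.1 p.2 \in E
             & generator (line e p.1 p.2) == Some p]].

Definition adj (E : {set {set T}}) : rel T :=
  [rel a b | ((a, b) \in generators E) || ((b, a) \in generators E)].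

Lemma generator_exists x y : d x y = 2 ->
  exists a b, [/\ d a b = 2, line e a b = line e x y
                & generator (line e x y) = Some (a, b)].
Proof.
move=> dxy; rewrite /generator; case: pickP => [[a b]|/(_ (x, y))].
  by case/andP=> /eqP dab /eqP Lab; exists a, b.
by rewrite /= dxy !eqxx.
Qed.

Lemma card_generators E : #|generators E| <= #|E|.
Proof.
have inj : {in generators E &, injective (fun p => line e p.1 p.2)}.
  move=> p q; rewrite !inE => /and3P[_ _ /eqP gp] /and3P[_ _ /eqP gq] L.
  by apply: Some_inj; rewrite -gp -gq L.
rewrite -(card_in_imset inj); apply/subset_leq_card/subsetP => l.
by case/imsetP=> p + ->; rewrite inE => /and3P[].
Qed.

Lemma adj_sym E : symmetric (adj E).
Proof. by move=> a b; apply: orbC. Qed.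

Lemma adj_connC E : connect_sym (adj E).
Proof. exact/sym_connect_sym/adj_sym. Qed.

Lemma adjP (E : {set {set T}}) x y : d x y = 2 -> line e x y \in E ->
  exists a b, [/\ d a b = 2, line e a b = line e x y & adj E a b].
Proof.
move=> dxy xyE; have [a [b [dab Lab g]]] := generator_exists dxy.
exists a, b; split=> //; apply/orP; left.
by rewrite inE /= dab Lab xyE g !eqxx.
Qed.

Lemma adj_lone (E : {set {set T}}) x y :
  d x y = 2 -> lone x y -> line e x y \in E -> adj E x y.
Proof.
move=> dxy lxy xyE; have [a [b [dab Lab]]] := adjP dxy xyE.
by case/orP: (loneP lxy dab Lab) => /eqP[-> ->] //; rewrite adj_sym.
Qed.

Lemma adj_dist2 E x y : adj E x y -> d x y = 2.
Proof. by case/orP; rewrite inE => /and3P[/eqP] //=; rewrite distC. Qed.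

Lemma adj_line (E : {set {set T}}) x y : adj E x y -> line e x y \in E.
Proof. by case/orP; rewrite inE => /and3P[_] //=; rewrite lineC. Qed.

Definition has_lone (s : bool) (E : {set {set T}}) : Prop :=
  forall p q, f p = s -> d p q = 2 -> lone p q -> line e p q \in E.

Lemma conn_lone E x y : has_lone (f x) E -> d x y = 2 -> lone x y ->
  connect (adj E) x y.
Proof. by move=> hE dxy lxy; apply/connect1/adj_lone/hE. Qed.

(* A common neighbour of [o] and [y] on a geodesic from [o] to [v] would be at
   the same distance from [u] and from [v], yet in the line. *)
Lemma conn_wide E x y u v : chained x y u v -> y != u -> has_lone (f x) E ->
  connect (adj E) x y.
Proof.
move=> ch yu hE; have [o [c [c' [exc exc' eoc oc']]]] := chained_split ch.
have [dxy duv L dxv] := ch; have [dxu dyv] := chained_dist ch.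
have eyc := chained_sub ch exc; have eyc' := chained_sub ch exc'.
have ox : o != x by apply: contraNneq oc' => ->.
have oy : o != y by apply: contraNneq oc' => ->.
have [oL dxo doy duo dvo] := chained_out ch exc eoc ox oy.
have ov : o != v by rewrite -dist_eq0 distC dvo addn2.
have [b eob dob] := dist_step ov.
have yb : ~~ e y b.
  apply/negP => eyb.
  have : b \in line e u v by rewrite -L lineC nbr_line // distC.
  have dvb : d v b = (d y u).+1.
    by move: dob; rewrite (distC o) dvo (distC b); clear; lia.
  have dub : d u b = (d y u).+1.
    move: (edge_dist u eob) (edge_dist u eyb).
    by rewrite (distC o) duo (distC b); clear; lia.
  (* With equal distances to [u] and [v], only a common neighbour is on the line; that would mean
     [d y u = 0], excluded by [yu]. *)
  rewrite line_cases // dub dvb -!dist_eq1 dub eqSS dist_eq0 (negPf yu).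
  by clear; lia.
have xb : ~~ e x b by apply: contra yb; apply: chained_sub ch _.
(* The path is [x], [o], [y]: the neighbours [b] and [c'] make the neighbourhood of [o] incomparable
   with those of [x] and [y]. *)
have lxo : lone x o by apply: (lone_unnested dxo exc' oc' eob xb).
have loy : lone o y by apply: (lone_unnested doy eob yb eyc' oc').
apply: (connect_trans (conn_lone hE dxo lxo)); apply: conn_lone doy loy.
by rewrite -(dist2_col dxo).
Qed.

(* The leaves [x] and [v] have disjoint neighbourhoods and the same vertices at
   distance 2 apart from [y].  They are joined through a vertex [o] that splits
   the neighbourhood of [x], a vertex [o'] that splits that of [v], or both. *)
Lemma conn_star E x y v : chained x y y v -> has_lone (f x) E ->
  connect (adj E) x v.
Proof.
move=> ch hE; have ch' := chainedC ch.
have [o [c [c2 [exc exc2 eoc oc2]]]] := chained_split ch.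
have [o' [c' [c2' [evc evc2 eoc' oc2']]]] := chained_split ch'.
have [dxy dyv _ dxv] := ch; rewrite distxx add0n in dxv.
have eyc := chained_sub ch exc; have eyc2 := chained_sub ch exc2.
have eyc' := chained_sub ch' evc; have eyc2' := chained_sub ch' evc2.
have ox : o != x by apply: contraNneq oc2 => ->.
have oy : o != y by apply: contraNneq oc2 => ->.
have ov : o' != v by apply: contraNneq oc2' => ->.
have oy' : o' != y by apply: contraNneq oc2' => ->.
have [oL dxo _ _] := chained_out ch exc eoc ox oy; rewrite distxx => dvo.
have [oL' dvo' _ _] := chained_out ch' evc eoc' ov oy'; rewrite distxx => dxo'.
rewrite add0n in dvo dxo'.
have disj b : e x b -> ~~ e v b.
  move=> exb; apply/negP => evb; have := edge_dist v exb.
  by move: evb; rewrite -dist_eq1 (distC b) => /eqP->; rewrite dxv; case.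
have [b evb eob] := dist2_common dvo.
have [b' exb' eob'] := dist2_common dxo'.
have hEv : has_lone (f v) E by rewrite -(dist2_col dyv) -(dist2_col dxy).
have x_o : connect (adj E) x o.
  apply: (conn_lone hE dxo (lone_unnested dxo exc2 oc2 eob _)).
  by apply/negP => /disj; rewrite evb.
have v_o' : connect (adj E) v o'.
  apply: (conn_lone hEv dvo' (lone_unnested dvo' evc2 oc2' eob' _)).
  exact: disj.
have [lvo|nvo] := boolP (lone v o).
  by apply: (connect_trans x_o); rewrite adj_connC; apply: conn_lone.
have [lxo|nxo] := boolP (lone x o').
  by apply: (connect_trans (conn_lone hE dxo' lxo)); rewrite adj_connC.
(* When both shorter paths fail, [v] is nested in [o] and [x] in [o']. Then [c2] and [c2'] make [o]
   and [o'] incomparable, and the path is [x], [o], [o'], [v]. *)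
have subv z : e v z -> e o z.
  move=> evz; apply: contraNT nvo => oz.
  by apply: (lone_unnested dvo evz oz eoc); exact: disj.
have subx z : e x z -> e o' z.
  move=> exz; apply: contraNT nxo => oz.
  by apply: (lone_unnested dxo' exz oz eoc'); apply/negP => /disj; rewrite evc.
have oo' : o != o' by apply: contraNneq oc2 => ->; exact: subx.
have doo' : d o o' = 2 by apply: (common_dist2 eoc (subx _ exc)).
apply: (connect_trans x_o); rewrite adj_connC; apply: (connect_trans v_o').
rewrite adj_connC; apply: conn_lone => //; first by rewrite -(dist2_col dxo).
by apply: (lone_unnested doo' (subv _ evc2) oc2' (subx _ exc2)).
Qed.

(** If another pair was chosen for the line, the two are chained. Disjoint pairs are handled by
    [conn_wide]; if they share a vertex, [conn_star] joins the far ends and the chosen pair leads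
    back to the shared vertex. *)
Lemma conn_line (E : {set {set T}}) x y :
  has_lone (f x) E -> d x y = 2 -> line e x y \in E -> connect (adj E) x y.
Proof.
move=> hE dxy xyE; have [a [b [dab Lab abE]]] := adjP dxy xyE.
have [/orP[]/eqP[E1 E2]|ns] := boolP (same_pair x y a b).
- by rewrite -E1 -E2 connect1.
- by rewrite adj_connC -E1 -E2 connect1.
have [x' [y' [u [v [xy uv ch]]]]] := chained_exists dxy dab (esym Lab) ns.
suff conn' : connect (adj E) x' y'.
  by case: xy conn' => -[-> ->] //; rewrite adj_connC.
have hE' : has_lone (f x') E.
  by case: xy => -[-> _] //; rewrite -(dist2_col dxy).
have [yu|yu] := eqVneq y' u; last exact: conn_wide ch yu hE'.
have uvE : adj E u v by case: uv => -[-> ->] //; rewrite adj_sym.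
rewrite -yu in ch uvE; apply: (connect_trans (conn_star ch hE')).
by rewrite adj_connC connect1.
Qed.

(** Every second vertex of a walk from [x] to [y] has the colour of [x], and consecutive ones are
    equal or at distance 2. *)
Lemma dist2_connected (r : rel T) x y : connect_sym r ->
  (forall p q, d p q = 2 -> connect r p q) -> f x = f y -> connect r x y.
Proof.
move=> r_sym r2 fxy.
pose P z := [exists w, [&& (w == z) || e w z, connect r x w & f w == f x]].
have : P y.
  apply: (connect_closed (e_conn x y)).
    by apply/existsP; exists x; rewrite !eqxx connect0.
  move=> z z' ezz' /existsP[w /and3P[/orP[/eqP wz|ewz] xw fw]].
    by apply/existsP; exists w; rewrite wz ezz' -wz orbT xw fw.
  apply/existsP; exists z'; rewrite eqxx /=.
  have [<-|wz'] := eqVneq w z'; first by rewrite xw fw.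
  have dwz' : d w z' = 2 by apply: (common_dist2 ewz) => //; rewrite e_sym.
  by rewrite (connect_trans xw (r2 _ _ dwz')) -(dist2_col dwz') fw.
case/existsP=> w /and3P[/orP[/eqP<- //|/f_col wy] _ /eqP fw].
by rewrite fw fxy eqxx in wy.
Qed.

Lemma lone_sym x y : lone y x = lone x y.
Proof.
apply: eq_forallb => u; apply: eq_forallb => v.
by rewrite (lineC y) /same_pair orbC.
Qed.

Lemma lone_line x y u v : lone x y -> d u v = 2 ->
  line e u v = line e x y -> lone u v.
Proof.
move=> lxy duv /(loneP lxy duv)/orP[]/eqP[-> ->] //.
by rewrite lone_sym.
Qed.

(** The vertex from [chained_split] provides a detour whose two lines both differ from that of [x]
    and [y], by [line_neq_out]. *)
Lemma not_lone_out x y : d x y = 2 -> ~~ lone x y ->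
  exists o, [/\ d x o = 2, d o y = 2 & o \notin line e x y].
Proof.
move=> dxy /(not_lone_chained dxy)[a [b [u [v [ab ch]]]]].
suff [o [dao dob oL]] :
    exists o, [/\ d a o = 2, d o b = 2 & o \notin line e a b].
  case: ab => -[E1 E2]; rewrite E1 E2 in dao dob oL; exists o => //.
  by split; rewrite 1?distC // lineC.
have [o [c [c' [eac eac' eoc oc']]]] := chained_split ch.
have ebc' := chained_sub ch eac'.
have oa : o != a by apply: contraNneq oc' => ->.
have ob : o != b by apply: contraNneq oc' => ->.
by have [] := chained_out ch eac eoc oa ob; exists o.
Qed.

Lemma line_neq_out x y o : o \notin line e x y ->
  line e x o != line e x y /\ line e o y != line e x y.
Proof.
move=> oL; split; apply: contraNneq oL => <-; last exact: mem_line.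
by rewrite lineC mem_line.
Qed.

(** Connectedness of each colour class costs at least its size minus one generators; the two removed
    lines make up for the deficit of 2. *)
Lemma generated_count (L : {set {set T}}) l1 l2 :
  l1 \in L -> l2 \in L -> l1 != l2 ->
  (forall p q, d p q = 2 -> connect (adj (L :\ l1 :\ l2)) p q) -> #|T| <= #|L|.
Proof.
move=> l1L l2L l12 conn; set E := L :\ l1 :\ l2 in conn *.
have -> : #|L| = #|E|.+2.
  by rewrite (cardsD1 l1) l1L (cardsD1 l2 (L :\ l1)) !inE eq_sym l12 l2L.
pose D := [set x | f x].
have side (D' : {set T}) : (D' == D) || (D' == ~: D) ->
    #|D'| <= #|[set p in generators E | p.1 \in D']|.+1.
  have colD' x y : (D' == D) || (D' == ~: D) -> f x = f y ->
      (x \in D') = (y \in D').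
    by move=> /orP[]/eqP->; rewrite !inE => ->.
  move=> hD; apply: connected_card => [[a b]|x y xD yD].
    by rewrite inE /= => /and3P[/eqP/dist2_col fab _ _]; apply: colD'.
  apply: (dist2_connected (adj_connC E) conn).
  by move: xD yD; case/orP: hD => /eqP->; rewrite !inE; move: (f x) (f y) => [] [].
rewrite -(cardsC D); have := side D; have := side (~: D).
rewrite !eqxx orbT => /(_ isT) s1 /(_ isT) s2; have := card_generators E.
have : #|generators E| = #|[set p in generators E | p.1 \in D]|
                       + #|[set p in generators E | p.1 \in ~: D]|.
  rewrite -(cardsID [set p | p.1 \in D]); congr (_ + _); apply: eq_card => p.
    by rewrite !inE.
  by rewrite !inE andbC.
by lia.
Qed.

(** * Two superfluous lines *)

Lemma conn_line_out (E : {set {set T}}) x y :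
  has_lone (f x) E -> d x y = 2 -> ~~ lone x y ->
  (forall p q, f p = f x -> d p q = 2 -> line e p q != line e x y ->
    connect (adj E) p q) -> connect (adj E) x y.
Proof.
move=> hE dxy nl conn; have [o [dxo doy oL]] := not_lone_out dxy nl.
have [n1 n2] := line_neq_out oL.
apply: connect_trans (conn _ _ _ dxo n1) (conn _ _ _ doy n2) => //.
by rewrite -(dist2_col dxo).
Qed.

(* If all pairs of colour [s] generate different lines, a pair of neighbours
   of [b] lies on a cycle of the graph of pairs at distance 2: [b] has a third
   neighbour, or [p] and [q] are joined in the graph without [b]. *)
Lemma conn_all_lone s b p q :
  (forall x y, f x = s -> d x y = 2 -> lone x y) ->
  f p = s -> e b p -> e b q -> p != q ->
  forall E : {set {set T}},
    (forall x y, f x = s -> d x y = 2 -> line e x y != line e p q ->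
       line e x y \in E) -> connect (adj E) p q.
Proof.
move=> all_lone fp ebp ebq pq E hE.
have epb : e p b by rewrite e_sym.
have eqb : e q b by rewrite e_sym.
have dpq : d p q = 2 by apply: (common_dist2 epb eqb).
have fq : f q = s by rewrite -(dist2_col dpq).
have edge x y : f x = s -> d x y = 2 -> ~~ same_pair p q x y ->
    connect (adj E) x y.
  move=> fx dxy ns; have lxy := all_lone _ _ fx dxy.
  apply/connect1/adj_lone => //; apply: hE => //; apply: contraNneq ns => L.
  exact: loneP (all_lone _ _ fp dpq) dxy L.
apply/negPn/negP => npq.
(* A third neighbour [t] of a common neighbour would give the path [p], [t], [q]. So all common
   neighbours have the same neighbourhood and coincide with [b]. *)
have only_b z : e z p -> e z q -> z = b.
  have nbrs z' : e z' p -> e z' q -> e z' =1 pred2 p q.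
    move=> ez'p ez'q t /=; apply/idP/orP => [ez't|[]/eqP-> //].
    apply/orP/negPn/negP; rewrite negb_or => /andP[tp tq].
    have dpt : d p t = 2 by apply: (common_dist2 (c := z')); rewrite 1?e_sym // eq_sym.
    have dtq : d t q = 2 by apply: (common_dist2 (c := z')); rewrite 1?e_sym.
    case/negP: npq; apply: (connect_trans (edge _ _ fp dpt _) (edge _ _ _ dtq _)).
    - by rewrite /same_pair !xpair_eqE (negPf tq) (negPf pq) andbF.
    - by rewrite -(dist2_col dpt).
    - by rewrite /same_pair !xpair_eqE (negPf tp) (negPf tq).
  move=> ezp ezq; apply: same_nbrs => t.
  by rewrite (nbrs z ezp ezq) (nbrs b ebp ebq).
have pb : p != b by apply: contraTneq ebp => ->; rewrite e_irr.
have qb : q != b by apply: contraTneq ebq => ->; rewrite e_irr.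
(* The invariant of [dist2_connected], along a walk avoiding [b]: a step between [p] and [q] would
   pass through their only common neighbour [b]. *)
pose P z := [exists w, [&& (w == z) || e w z, connect (adj E) p w & f w == s]].
have : P q.
  apply: (connect_closed (connect_del pb qb)).
    by apply/existsP; exists p; rewrite eqxx connect0 fp eqxx.
  move=> z z' /and3P[ezz' zb _] /existsP[w /and3P[/orP[/eqP wz|ewz] pw fw]].
    by apply/existsP; exists w; rewrite wz ezz' -wz orbT pw fw.
  apply/existsP; exists z'; rewrite eqxx /=.
  have [<-|wz'] := eqVneq w z'; first by rewrite pw fw.
  have dwz' : d w z' = 2 by apply: (common_dist2 ewz) => //; rewrite e_sym.
  rewrite -(dist2_col dwz') fw andbT; apply: (connect_trans pw).
  apply: edge => //; first exact/eqP.
  apply/orP => -[/eqP[E1 E2]|/eqP[E1 E2]]; case/eqP: zb; apply: only_b;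
    by rewrite -?E1 -?E2 // e_sym.
case/existsP=> w /and3P[/orP[/eqP w_q|/f_col wq] pw /eqP fw].
  by rewrite -w_q pw in npq.
by rewrite fw fq eqxx in wq.
Qed.

Lemma conn_color s : exists p q, [/\ f p = s, d p q = 2 &
  forall E : {set {set T}},
    (forall x y, f x = s -> d x y = 2 -> line e x y != line e p q ->
       line e x y \in E) ->
    forall x y, f x = s -> d x y = 2 -> connect (adj E) x y].
Proof.
have [[p q]|all_lone] :=
    pickP (fun p => [&& f p.1 == s, d p.1 p.2 == 2 & ~~ lone p.1 p.2]).
  case/and3P=> /eqP /= fp /eqP dpq npq; exists p, q; split=> // E hE x y fx dxy.
  have hEs x' y' : f x' = s -> d x' y' = 2 -> lone x' y' -> line e x' y' \in E.
    move=> fx' dx'y' lx'y'; apply: hE => //; apply: contraNneq npq => L.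
    exact: lone_line lx'y' dpq (esym L).
  have [L|nL] := eqVneq (line e x y) (line e p q); last first.
    by apply: conn_line; rewrite ?fx //; apply: hE.
  have [lxy|nlxy] := boolP (lone x y).
    by apply: conn_lone; rewrite ?fx.
  apply: conn_line_out; rewrite ?fx // => x' y' fx' dx'y' nL.
  by apply: conn_line; rewrite ?fx' //; apply: hE; rewrite // -L.
have {}all_lone x y : f x = s -> d x y = 2 -> lone x y.
  by move=> fx dxy; have := all_lone (x, y); rewrite /= fx dxy !eqxx; case: lone.
have [b fb] : exists b, f b = ~~ s.
  have /card_gt0P[x _] : 0 < #|T| by apply: leq_trans e_card.
  have [fx|fx] := eqVneq (f x) s; last by exists x; case: (f x) (s) fx => -[].
  by have [y /edge_colC] := has_nbr x; rewrite fx; exists y.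
have [p ebp] := has_nbr b; have [q ebq qp] := other_nbr ebp.
have fp : f p = s by rewrite (edge_colC ebp) fb negbK.
have dpq : d p q = 2.
  by apply: (common_dist2 (c := b)); rewrite 1?e_sym // eq_sym.
exists p, q; split=> // E hE.
have cpq : connect (adj E) p q.
  by apply: (conn_all_lone all_lone fp ebp ebq _ hE); rewrite eq_sym.
move=> x y fx dxy; have [L|nL] := eqVneq (line e x y) (line e p q); last first.
  by apply/connect1/adj_lone; [|exact: all_lone|exact: hE].
have [/eqP[-> ->] //|/eqP[-> ->]] := orP (loneP (all_lone _ _ fp dpq) dxy L).
by rewrite adj_connC.
Qed.

Lemma same_pair_col x y u v : d x y = 2 -> same_pair x y u v -> f u = f x.
Proof. by move/dist2_col=> fxy /orP[]/eqP[-> _]. Qed.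

(** The line itself may be missing from [E]: compared with a generating pair of the other colour,
    [a] and [b] share no vertex with it, so [conn_wide] applies. *)
Lemma conn_mixed (E : {set {set T}}) x y u v a b : (forall s, has_lone s E) ->
  d x y = 2 -> d u v = 2 -> line e u v = line e x y -> f x != f u ->
  d a b = 2 -> line e a b = line e x y -> connect (adj E) a b.
Proof.
move=> hE dxy duv L xu dab Lab.
wlog ax : x y u v dxy duv L xu Lab / f a != f x => [IH|].
  have [fax|ax] := eqVneq (f a) (f x); last exact: (IH x y u v).
  by apply: (IH u v x y); rewrite ?L ?fax // eq_sym.
have ns : ~~ same_pair a b x y.
  by apply: contra ax => /(same_pair_col dab) ->.
have [a' [b' [c [g [ab cg ch]]]]] := chained_exists dab dxy Lab ns.
suff conn' : connect (adj E) a' b'.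
  by case: ab conn' => -[-> ->] //; rewrite adj_connC.
apply: (conn_wide ch) => //; apply: contraNneq ax => bc.
have -> : f a = f b' by case: ab => -[_ ->] //; rewrite (dist2_col dab).
by rewrite bc; case: cg => -[-> _] //; rewrite (dist2_col dxy).
Qed.

Lemma line_neq_nbrs x y u v : d x y = 2 -> e y u -> e y v -> u != v ->
  line e u v != line e x y.
Proof.
move=> dxy eyu eyv uv; apply/eqP => L.
have duv : d u v = 2 by apply: (common_dist2 (c := y)); rewrite 1?e_sym.
have dyx : d y x = 2 by rewrite distC.
by apply: (end_not_middle dyx duv _ eyu eyv); rewrite L lineC.
Qed.

Definition dist2_lines : {set {set T}} :=
  [set line e x y | x in T, y in T & d x y == 2].

Lemma mem_dist2_lines x y : d x y = 2 -> line e x y \in dist2_lines.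
Proof. by move=> dxy; apply/imset2P; exists x y; rewrite // inE dxy. Qed.

(* A chained pair [a b] is removed with any other line having several
   generators or, failing that, with a line generated by two neighbours of [b]:
   [b] has three neighbours because those of [a] form a proper subset. *)
Lemma card_le_mixed x y u v : d x y = 2 -> d u v = 2 ->
  line e u v = line e x y -> f x != f u -> #|T| <= #|dist2_lines|.
Proof.
move=> dxy duv Luv xu; have inL := mem_dist2_lines.
set L := dist2_lines; set l := line e x y.
have ns : ~~ same_pair x y u v.
  by apply: contra xu => /(same_pair_col dxy) ->.
have [a [b [a' [b' [ab _ ch]]]]] := chained_exists dxy duv (esym Luv) ns.
have lab : line e a b = l by case: ab => -[-> ->] //; rewrite lineC.
have not_lone_l p q : d p q = 2 -> lone p q -> line e p q != l.
  move=> dpq lpq; apply: contraNneq (chained_not_lone ch) => Lpq.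
  by have [dab _ _ _] := ch; apply: lone_line lpq dab _; rewrite lab.
have [[p q]|one_line] :=
    pickP (fun p => [&& d p.1 p.2 == 2, ~~ lone p.1 p.2 & line e p.1 p.2 != l]).
  case/and3P=> /eqP /= dpq npq nL.
  apply: (@generated_count L l (line e p q)); rewrite ?inL // 1?eq_sym //.
  set E := _ :\ _.
  have hE s : has_lone s E.
    move=> p' q' _ dpq' lpq'; rewrite !inE inL // not_lone_l // !andbT.
    by apply: contraNneq npq => L'; apply: lone_line lpq' dpq (esym L').
  have conn p' q' : d p' q' = 2 -> line e p' q' != line e p q ->
      connect (adj E) p' q'.
    move=> dpq' nL'; have [L'|nl] := eqVneq (line e p' q') l.
      exact: conn_mixed hE dxy duv Luv xu dpq' L'.
    by apply: conn_line => //; rewrite !inE nL' nl inL.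
  move=> p' q' dpq'; have [L'|nL'] := eqVneq (line e p' q') (line e p q);
    last exact: conn.
  have npq' : ~~ lone p' q'.
    by apply: contra npq => lpq'; apply: lone_line lpq' dpq (esym L').
  apply: conn_line_out => // p0 q0 _ dpq0 nL2.
  by apply: conn => //; rewrite -L'.
have lone_all p q : d p q = 2 -> line e p q != l -> lone p q.
  move=> dpq nL; have := one_line (p, q); rewrite /= dpq nL eqxx andbT /=.
  by move/negbFE.
have [dab _ _ _] := ch.
have [c eac] := has_nbr a; have [c' eac' c'c] := other_nbr eac.
have ebc := chained_sub ch eac; have ebc' := chained_sub ch eac'.
have [t ebt nat] : exists2 t, e b t & ~~ e a t.
  have [t /andP[]|sub] := pickP (fun t => e b t && ~~ e a t); first by exists t.
  suff E : a = b by rewrite E distxx in dab.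
  apply: same_nbrs => t; apply/idP/idP => [/(chained_sub ch)//|ebt].
  by have := sub t; rewrite ebt => /negbFE.
have ct : c != t by apply: contraNneq nat => <-.
have c't : c' != t by apply: contraNneq nat => <-.
have cc' : c != c' by rewrite eq_sym.
have nb p q : e b p -> e b q -> p != q -> d p q = 2 /\ line e p q != l.
  move=> ebp ebq pq; split; last by rewrite -lab line_neq_nbrs.
  by apply: (common_dist2 (c := b)); rewrite 1?e_sym.
have [dcc' ncc'] := nb _ _ ebc ebc' cc'.
have [dct nct] := nb _ _ ebc ebt ct.
have [dtc' ntc'] : d t c' = 2 /\ line e t c' != l by apply: nb; rewrite // eq_sym.
have lcc' := lone_all _ _ dcc' ncc'.
apply: (@generated_count L l (line e c c')); rewrite ?inL // 1?eq_sym //.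
set E := _ :\ _ => p q dpq.
(* With only [l] removed everything is joined by [conn_mixed] and [conn_line]. Removing the second
   line loses only the edge between [c] and [c'], replaced by the path [c], [t], [c']. *)
have conn1 : connect (adj (L :\ l)) p q.
  have hE s : has_lone s (L :\ l).
    by move=> p' q' _ dpq' lpq'; rewrite !inE inL // not_lone_l.
  have [Lpq|nL] := eqVneq (line e p q) l.
    exact: conn_mixed hE dxy duv Luv xu dpq Lpq.
  by apply: conn_line; rewrite // !inE nL inL.
apply: (connect_sub _ conn1) => p' q' adjpq.
have dpq' := adj_dist2 adjpq.
have := adj_line adjpq; rewrite !inE => /andP[nL _].
have adjE p0 q0 : d p0 q0 = 2 -> line e p0 q0 != l ->
    line e p0 q0 != line e c c' -> connect (adj E) p0 q0.
  move=> d0 n0 n0'; apply/connect1/adj_lone => //; first exact: lone_all.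
  by rewrite !inE n0 n0' inL.
have [L'|] := eqVneq (line e p' q') (line e c c'); last exact: adjE.
have cc'E : connect (adj E) c c'.
  apply: (connect_trans (adjE _ _ dct nct _) (adjE _ _ dtc' ntc' _)).
    apply/eqP => /(loneP lcc' dct)/orP[]/eqP[]; first by move/eqP: c't => + /esym.
    by move=> E1; rewrite E1 eqxx in cc'.
  apply/eqP => /(loneP lcc' dtc')/orP[]/eqP[]; first by move/eqP: ct => + /esym.
  by move=> E1; rewrite E1 eqxx in c't.
case/orP: (loneP lcc' dpq' L') => /eqP[-> ->] //.
by rewrite adj_connC.
Qed.

Lemma card_le_dist2_lines : #|T| <= #|dist2_lines|.
Proof.
have inL := mem_dist2_lines.
have [[[x y] [u v]]|unmixed] := pickP (fun w : (T * T) * (T * T) =>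
    [&& d w.1.1 w.1.2 == 2, d w.2.1 w.2.2 == 2,
        line e w.2.1 w.2.2 == line e w.1.1 w.1.2 & f w.1.1 != f w.2.1]).
  rewrite /= => /and4P[/eqP dxy /eqP duv /eqP Luv xu].
  exact: card_le_mixed dxy duv Luv xu.
have [p [q [fp dpq connT]]] := conn_color true.
have [p' [q' [fp' dpq' connF]]] := conn_color false.
have unmix x y u v : d x y = 2 -> d u v = 2 -> f x != f u ->
    line e u v != line e x y.
  move=> dxy duv xu; apply/negP => Luv.
  by have := unmixed ((x, y), (u, v)); rewrite /= dxy duv Luv xu.
apply: (@generated_count dist2_lines (line e p q) (line e p' q')); rewrite ?inL //.
  by apply: unmix; rewrite // fp fp'.
move=> x y dxy; case fx: (f x); [apply: connT|apply: connF] => //.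
  move=> x' y' fx' dxy' nL; rewrite !inE nL inL // !andbT.
  by apply: unmix; rewrite // fp' fx'.
move=> x' y' fx' dxy' nL; rewrite !inE nL inL // !andbT.
by apply: unmix; rewrite // fp fx'.
Qed.

End TwoConnectedBipartite.

Theorem theorem2 (T : finType) (e : rel T)
    (e_sym : symmetric e) (e_irr : irreflexive e)
    (e_2conn : two_connected e) (e_bip : bipartite e)
    (e_notwins : forall v v' : T, ~ twins e v v') :
  #|T| <= ell2 e.
Proof.
have [e_conn e_card e_nocut] := e_2conn; have [A e_col] := e_bip.
exact: (@card_le_dist2_lines _ e e_sym e_irr e_conn (fun x => x \in A)).
Qed.
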